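(* Let $(\vec x,\vec y)$ be a Fibonacci positive specialization of convergent type, i.e. $x_k=c_k(1+t_{k-1})$, $y_k=c_kc_{k+1}t_k$ ($k\ge1$, $t_0=0$) with $\vec c$ a positive sequence and $\vec t$ a positive sequence of convergent type, and suppose that $\mu_{\mathrm I}(1^\infty)>0$. Let $\varphi_{\vec x,\vec y}(w)=s_w(\vec x\mid\vec y)/(x_1\cdots x_{|w|})$ be the clone harmonic function. Then the unique probability measure $\mu$ on the set $\Upsilon_{\mathrm{ext}}(\mathbb{YF})$ of extremal nonnegative normalized harmonic functions representing $\varphi_{\vec x,\vec y}$ (in the sense $\varphi_{\vec x,\vec y}(w)=\int\varphi_\omega(w)\,\mu(d\omega)$ for all $w$) coincides with its Type-I component $\mu_{\mathrm I}$: it is supported on $\Phi_{1^\infty}$ and the $\Phi_{1^\infty2w}$, $w\in\mathbb{YF}$, with masses $\mu_{\mathrm I}(1^\infty)$ and $\mu_{\mathrm I}(1^\infty2w)$. Consequently, $$\varphi_{\vec x,\vec y}=\mu_{\mathrm I}(1^\infty)\,\Phi_{1^\infty}+\sum_{w\in\mathbb{YF}}\mu_{\mathrm I}(1^\infty2w)\,\Phi_{1^\infty2w}.$$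
   Context: A Fibonacci word is a finite (possibly empty) word in the letters $1,2$; $|w|$ is the sum of its letters; $\mathbb{YF}_n$ is the set of words of weight $n$, $\mathbb{YF}=\bigcup_n\mathbb{YF}_n$. The covering relation $w\nearrow w'$ (with $|w'|=|w|+1$) holds iff $w'=1w$, or $w'=2v$ with $v\nearrow w$ (base case $\varnothing\nearrow1$); $\unlhd$ is the induced partial order; $\dim(u,v)$ is the number of saturated chains from $u$ to $v$, and $\dim(w)=\dim(\varnothing,w)$. A function $\varphi$ on $\mathbb{YF}$ is harmonic if $\varphi(w)=\sum_{w':w\nearrow w'}\varphi(w')$, and normalized if $\varphi(\varnothing)=1$. The nonnegative normalized harmonic functions form a simplex with set of extreme points $\Upsilon_{\mathrm{ext}}(\mathbb{YF})$. For sequences $\vec x,\vec y$: $A_\ell$ ($A_0=1$) is the determinant of the $\ell\times\ell$ tridiagonal matrix with diagonal $x_1,\ldots,x_\ell$, superdiagonal $y_1,\ldots,y_{\ell-1}$ and subdiagonal entries $1$; $B_k(m)$ is the determinant of the $(k+1)\times(k+1)$ tridiagonal matrix with diagonal $y_{m+1},x_{m+3},\ldots,x_{m+k+2}$, superdiagonal $x_{m+1}y_{m+2},y_{m+3},\ldots,y_{m+k+1}$, subdiagonal entries $1$. Clone Schur functions: $s_{1^k}=A_k$, $s_{1^k2u}=B_k(|u|)\,s_u$. Convergent type: with $A_\infty(m)=1+\sum_{r\ge1}t_m\cdots t_{m+r-1}$ and $B_\infty(m)=t_{m+1}+(t_{m+1}-t_m-1)t_{m+2}A_\infty(m+3)$,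 all $A_\infty(m)$ converge and $B_\infty(m)\ge0$ for all $m\ge0$. With $M_n(w)=\dim(w)\varphi_{\vec x,\vec y}(w)$ for $w\in\mathbb{YF}_n$, the Type-I component is $\mu_{\mathrm I}(1^\infty w)=\lim_{n\to\infty}M_{n+|w|}(1^nw)$ (in particular $\mu_{\mathrm I}(1^\infty)=\lim_n M_n(1^n)$, $\mu_{\mathrm I}(1^\infty2w)=\lim_nM_{n+|w|+2}(1^n2w)$). Type-I harmonic functions (which are extremal): $\Phi_{1^\infty}(v)=1$ if $v=1^k$ for some $k\ge0$ and $0$ otherwise; $\Phi_{1^\infty2w}(v)=\dim(v,1^k2w)/\dim(2w)$ if $v\unlhd1^k2w$ for some $k\ge0$ (the value does not depend on such $k$), and $0$ otherwise. *)

(* Defs.v *)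
From HB Require Import structures.
From mathcomp Require Import all_boot all_order all_algebra finmap.
From mathcomp Require Import all_classical all_reals all_analysis lra.

Set Implicit Arguments.
Unset Strict Implicit.
Unset Printing Implicit Defensive.

Import Order.TTheory GRing.Theory Num.Theory.
Import numFieldNormedType.Exports.

Local Open Scope classical_set_scope.
Local Open Scope ring_scope.

Variant letter := One | Two.

Definition bool_of_letter (a : letter) : bool := if a is One then false else true.
Definition letter_of_bool (b : bool) : letter := if b then Two else One.
Lemma bool_of_letterK : cancel bool_of_letter letter_of_bool.
Proof. by case. Qed.
HB.instance Definition _ := Countable.copy letter (can_type bool_of_letterK).

(* Fibonacci words; the head of the list is the leftmost letter. *)
Definition fword := seq letter.

Definition weight (w : fword) : nat :=
  (\sum_(a <- w) (if a is One then 1 else 2))%N.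

Definition ones (k : nat) : fword := nseq k One.

(* The base case of the recursion, [::] covered by [:: One], is covers_one [::]. *)
Inductive covers : fword -> fword -> Prop :=
| covers_one w : covers w (One :: w)
| covers_two v w : covers v w -> covers w (Two :: v).

(* s is the list of the vertices after u on a saturated chain from u to v. *)
Definition saturated_chains (u v : fword) : set (seq fword) :=
  [set s | path (fun a b => `[< covers a b >]) u s /\ last u s = v].

Definition below (u v : fword) : Prop := saturated_chains u v !=set0.

(* fset_set is meaningful here by finite_saturated_chains below. *)
Definition dim (u v : fword) : nat := #|` fset_set (saturated_chains u v)|%fset.

Section Finiteness.

Lemma up_coversE w : [set w' | covers w w'] =
  [set One :: w] `|` (cons Two @` [set v | covers v w]).
Proof.
apply/seteqP; split => w' /=.
- by move=> cw; inversion cw; subst; [left | right; exists v].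
- by move=> [->|[v cv <-]]; constructor.
Qed.

Lemma down_covers_nil : [set v | covers v [::]] = set0.
Proof. by apply/seteqP; split => // v /= cv; inversion cv. Qed.

Lemma down_covers_one u : [set v | covers v (One :: u)] = [set u].
Proof.
apply/seteqP; split => v /=; first by move=> cv; inversion cv.
by move=> ->; constructor.
Qed.

Lemma down_covers_two u : [set v | covers v (Two :: u)] = [set v | covers u v].
Proof.
apply/seteqP; split => v /=; first by move=> cv; inversion cv.
by constructor.
Qed.

Lemma finite_covers w :
  finite_set [set v | covers v w] /\ finite_set [set w' | covers w w'].
Proof.
elim: w => [|a w [_ IHu]].
  rewrite up_coversE down_covers_nil image_set0 setU0.
  by split; [exact: finite_set0 | exact: finite_set1].
have fd : finite_set [set v | covers v (a :: w)].
  case: a; first by rewrite down_covers_one; exact: finite_set1.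
  by rewrite down_covers_two.
split => //; rewrite up_coversE finite_setU; split; first exact: finite_set1.
exact: finite_image.
Qed.

Lemma weight_covers v w : covers v w -> weight w = (weight v).+1.
Proof.
elim=> {v w} [w|v w _ IH]; first by rewrite /weight big_cons.
by rewrite {1}/weight big_cons -/(weight v) IH.
Qed.

Lemma weight_chain u s : path (fun a b => `[< covers a b >]) u s ->
  weight (last u s) = (weight u + size s)%N.
Proof.
elim: s u => [|a s IH] u /=; first by rewrite addn0.
by move=> /andP[/asboolP ca /IH ->]; rewrite (weight_covers ca) addSnnS.
Qed.

Lemma finite_saturated_chains u v : finite_set (saturated_chains u v).
Proof.
have H n a : finite_set
    [set s | path (fun a b => `[< covers a b >]) a s /\ size s = n].
  elim: n a => [|n IH] a.
    apply: (@sub_finite_set _ _ [set [::]]); last exact: finite_set1.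
    by move=> s /= [_ /eqP]; rewrite size_eq0 => /eqP.
  apply: (@sub_finite_set _ _ (\bigcup_(b in [set b | covers a b]) (cons b @`
     [set s | path (fun a b => `[< covers a b >]) b s /\ size s = n]))).
    move=> [|b s] /= [] // /andP[/asboolP ab ps] [ss].
    by exists b => //; exists s.
  apply: bigcup_finite; first exact: (finite_covers a).2.
  by move=> b _; exact: finite_image.
apply: sub_finite_set (H (weight v - weight u)%N u) => s /= [ps <-].
by split => //; rewrite (weight_chain ps) addKn.
Qed.

End Finiteness.

Section Harmonic.
Variable R : realType.
Implicit Types phi psi : fword -> R.

(* The index set of this sum is finite by finite_covers. *)
Definition harmonic phi :=
  forall w, phi w = \sum_(w' \in [set w' | covers w w']) phi w'.

Definition normalized_nonneg_harmonic phi :=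
  [/\ forall w, 0 <= phi w, phi [::] = 1 & harmonic phi].

(* Extreme points of the convex set of normalized nonnegative harmonic functions. *)
Definition extremal phi :=
  normalized_nonneg_harmonic phi /\
  forall (psi1 psi2 : fword -> R) (p : R),
    normalized_nonneg_harmonic psi1 -> normalized_nonneg_harmonic psi2 ->
    0 < p < 1 -> (forall w, phi w = p * psi1 w + (1 - p) * psi2 w) ->
    psi1 = phi /\ psi2 = phi.

Definition Phi1 : fword -> R := fun v => `[< exists k, v = ones k >]%:R.

(* The value does not depend on the k selected by xget. *)
Definition Phi12 (w : fword) : fword -> R := fun v =>
  let K := [set k | below v (ones k ++ Two :: w)] in
  if `[< K !=set0 >] then
    (dim v (ones (xget 0%N K) ++ Two :: w))%:R / (dim [::] (Two :: w))%:R
  else 0.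

Lemma Phi1_ones k : Phi1 (ones k) = 1.
Proof. by rewrite /Phi1 (_ : `[< _ >] = true) //; apply/asboolP; exists k. Qed.

Lemma Phi1_Two v : Phi1 (Two :: v) = 0.
Proof.
by rewrite /Phi1 (_ : `[< _ >] = false) //; apply/asboolPn => -[[]].
Qed.

Lemma Phi1_One v : Phi1 (One :: v) = Phi1 v.
Proof.
rewrite /Phi1; congr (nat_of_bool _)%:R; apply/asbool_equiv_eq.
split=> [[[|k] //= [->]]|[k ->]]; first by exists k.
by exists k.+1.
Qed.

Lemma sum_coversE phi w : \sum_(w' \in [set w' | covers w w']) phi w' =
  phi (One :: w) + \sum_(v \in [set v | covers v w]) phi (Two :: v).
Proof.
rewrite up_coversE fsbigU0.
- rewrite fsbig_set1; congr (_ + _); apply: reindex_fsbig; split.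
  + by move=> v cv; exists v.
  + by move=> v v' _ _ [].
  + by move=> _ [v cv <-]; exists v.
- exact: finite_set1.
- by apply: finite_image; exact: (finite_covers w).1.
- by move=> u [/= ->] [].
Qed.

Lemma harmonic_One_le phi w : normalized_nonneg_harmonic phi ->
  phi (One :: w) <= phi w.
Proof.
move=> [p0 _ hp]; rewrite [leRHS]hp sum_coversE lerDl.
by apply: fsumr_ge0 => *; exact: p0.
Qed.

Lemma Phi1_extremal : extremal Phi1.
Proof.
have le1 psi k : normalized_nonneg_harmonic psi -> psi (ones k) <= 1.
  move=> hpsi; elim: k => [|k IH]; first by case: hpsi => _ /= ->.
  exact: le_trans (harmonic_One_le _ hpsi) IH.
split.
  split; first by move=> w; rewrite /Phi1 ler0n.
    exact: (Phi1_ones 0).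
  move=> w; rewrite sum_coversE Phi1_One fsbig1 ?addr0// => v _.
  exact: Phi1_Two.
move=> psi1 psi2 p h1 h2 /andP[p0 p1] e.
suff H v : psi1 v = Phi1 v /\ psi2 v = Phi1 v.
  by split; apply/funext => v; case: (H v).
have p1' : 0 < 1 - p by rewrite subr_gt0.
have a1 : 0 <= psi1 v by case: h1.
have a2 : 0 <= psi2 v by case: h2.
have := e v.
case: (pselect (exists k, v = ones k)) => [[k vk]|nk].
  have b1 : psi1 v <= 1 by rewrite vk; exact: le1.
  have b2 : psi2 v <= 1 by rewrite vk; exact: le1.
  by rewrite vk Phi1_ones -vk => ev; split; nra.
rewrite {1 2 3}/Phi1 (_ : `[< _ >] = false)/=; last exact/asboolPn.
by move=> ev; split; nra.
Qed.

End Harmonic.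

(* The set of extremal functions, with the sigma-algebra generated by the
   evaluations phi |-> phi w.  As there are countably many words, this is the Borel
   sigma-algebra of the topology of pointwise convergence. *)
Record extremal_boundary (R : realType) := ExtremalBoundary {
  ext_fun :> fword -> R;
  ext_funP : extremal ext_fun }.

HB.instance Definition _ R := gen_eqMixin (extremal_boundary R).
HB.instance Definition _ R := gen_choiceMixin (extremal_boundary R).
HB.instance Definition _ R :=
  isPointed.Build (extremal_boundary R) (ExtremalBoundary (Phi1_extremal R)).

Definition evaluation_sets (R : realType) : set (set (extremal_boundary R)) :=
  \bigcup_(w in [set: fword])
    preimage_set_system setT (fun om : extremal_boundary R => om w)
      (measurable : set (set R)).

HB.instance Definition _ R := Measurable.copy (extremal_boundary R)
  (g_sigma_algebraType (@evaluation_sets R)).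

Definition represents (R : realType)
    (mu : probability (extremal_boundary R) R) (phi : fword -> R) :=
  forall w, (phi w)%:E = (\int[mu]_om (om w)%:E)%E.

Section CloneSchur.
Variable R : realType.
Implicit Types x y c t d u : nat -> R.

Definition tridiag d u n : 'M[R]_n := \matrix_(i < n, j < n)
  (if j == i :> nat then d i
   else if j == i.+1 :> nat then u i
   else if i == j.+1 :> nat then 1 else 0).

(* Sequences x, y, c are indexed from 1: their value at 0 is never used. *)
Definition cloneA x y (l : nat) : R :=
  \det (tridiag (fun i => x i.+1) (fun i => y i.+1) l).

Definition cloneB x y (k m : nat) : R :=
  \det (tridiag (fun i => if i == 0%N then y m.+1 else x (m + i + 2)%N)
                (fun i => if i == 0%N then x m.+1 * y m.+2 else y (m + i + 2)%N)
                k.+1).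

(* clone_schur_rec x y k w is the clone Schur function of ones k ++ w. *)
Fixpoint clone_schur_rec x y (k : nat) (w : fword) : R :=
  match w with
  | [::] => cloneA x y k
  | One :: v => clone_schur_rec x y k.+1 v
  | Two :: v => cloneB x y k (weight v) * clone_schur_rec x y 0 v
  end.

Definition clone_schur x y (w : fword) : R := clone_schur_rec x y 0 w.

Definition clone_harmonic x y (w : fword) : R :=
  clone_schur x y w / \prod_(1 <= i < (weight w).+1) x i.

Definition Ainf_series t (m : nat) : R^nat :=
  series (fun r => \prod_(m <= i < m + r.+1) t i).

Definition Ainf t (m : nat) : R := 1 + limn (Ainf_series t m).

Definition Binf t (m : nat) : R :=
  t m.+1 + (t m.+1 - t m - 1) * t m.+2 * Ainf t (m + 3).

Definition convergent_type t :=
  (forall m, cvgn (Ainf_series t m)) /\ (forall m, 0 <= Binf t m).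

Definition coherent_measure x y (w : fword) : R :=
  (dim [::] w)%:R * clone_harmonic x y w.

(* The mass at 1^oo w, as a function of w. *)
Definition muI x y (w : fword) : R :=
  limn (fun n => coherent_measure x y (ones n ++ w)).

Definition typeI_component x y (A : set (extremal_boundary R)) : \bar R :=
  ((muI x y [::] * \1_(@ext_fun R @` A) (@Phi1 R))%:E +
   \esum_(w in [set: fword])
     (muI x y (Two :: w) * \1_(@ext_fun R @` A) (@Phi12 R w))%:E)%E.

End CloneSchur.

(* Main.v *)
(* For a word [w], the normalized weights [dim w * f (1^n w)] of a nonnegative harmonic
   function [f] decrease to a limit [m_w(f)], and [m_w(f) * Phi_w <= f], where [Phi_w] is
   the harmonic function of the path [1^oo w].  Hence [Phi_w] is extremal, and [m_w] is the
   indicator of [Phi_w] on extremal functions, so that by dominated convergence every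
   measure representing [f] gives mass [m_w(f)] to [Phi_w].  When these masses add up to
   [1], they exhaust both [f] and any representing measure.
   For the clone function, put [P_n = (1 + t_0) ... (1 + t_(n-1))], whose limit is [1 / a]
   with [a = muI(1^oo)], and [G_m = P_m (t_(m+1) + t_(m+1) t_(m+2) + ...)].  The words
   [1^oo 2 w] with [w] of weight [m] carry the mass [a (m+1) (G_m - G_(m+1))].  As [G]
   decreases and [sum_m G_m = 1/a - 1], summation by parts gives the total mass
   [a + a (1/a - 1) = 1]. *)
From HB Require Import structures.
From mathcomp Require Import all_boot all_order all_algebra finmap.
From mathcomp Require Import all_classical all_reals all_analysis measurable_realfun.
From mathcomp Require Import zify lra ring.
Require Import Defs.

Set Implicit Arguments.
Unset Strict Implicit.
Unset Printing Implicit Defensive.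

Import Order.TTheory GRing.Theory Num.Theory.
Import numFieldNormedType.Exports.
Local Open Scope classical_set_scope.
Local Open Scope ring_scope.

(** * Chains in the Young-Fibonacci lattice *)

(** The inner [match] is [lower_covers w] written out, so that one structural recursion yields both
    lists. *)
Fixpoint upper_covers (w : fword) : seq fword :=
  (One :: w) :: [seq Two :: v | v <- match w with
                                     | [::] => [::]
                                     | One :: v => [:: v]
                                     | Two :: v => upper_covers v
                                     end].

Definition lower_covers (w : fword) : seq fword :=
  match w with
  | [::] => [::]
  | One :: v => [:: v]
  | Two :: v => upper_covers v
  end.

Lemma upper_coversE (w : fword) :
  upper_covers w = (One :: w) :: [seq Two :: v | v <- lower_covers w].
Proof. by case: w => [|[]]. Qed.

(** One induction serves both equivalences, because the lower covers of [Two :: v] are the upper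
    covers of [v]. *)
Lemma covers_upperP (v w : fword) :
  (covers v w <-> w \in upper_covers v) /\ (covers w v <-> w \in lower_covers v).
Proof.
elim: v w => [|a v IH] w.
  rewrite upper_coversE /= inE; split; split.
  - by move=> h; inversion h as [|x z cx]; subst => //; inversion cx.
  - by move=> /eqP ->; constructor.
  - by move=> h; inversion h.
  - by [].
have hd u : covers u (a :: v) <-> u \in lower_covers (a :: v).
  case: a; split => /=.
  - by move=> h; inversion h; rewrite inE.
  - by rewrite inE => /eqP ->; constructor.
  - by move=> h; inversion h; apply/(IH u).1.
  - by move=> /(IH u).1 h; constructor.
split; last exact: hd.
rewrite upper_coversE inE; split.
- move=> h; inversion h; subst; first by rewrite eqxx.
  by apply/orP; right; apply: map_f; apply/hd.
- move=> /orP[/eqP ->|/mapP[u /hd hu ->]]; by constructor.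
Qed.

Lemma uniq_covers (w : fword) : uniq (upper_covers w) /\ uniq (lower_covers w).
Proof.
elim: w => [//|a w [IH _]].
have h : uniq (lower_covers (a :: w)) by case: a.
split => //; rewrite upper_coversE /= map_inj_uniq ?h ?andbT; last by move=> ? ? [].
by apply/negP => /mapP[].
Qed.

Lemma upper_coversP (v w : fword) : reflect (covers v w) (w \in upper_covers v).
Proof. by apply: (iffP idP) => /(covers_upperP v w).1. Qed.

Lemma lower_coversP (v w : fword) : reflect (covers w v) (w \in lower_covers v).
Proof. by apply: (iffP idP) => /(covers_upperP v w).2. Qed.

Lemma mem_lower_covers (v w : fword) : (v \in lower_covers w) = (w \in upper_covers v).
Proof. by apply/lower_coversP/upper_coversP. Qed.

(** * Weights of words *)

Lemma weight_One (w : fword) : weight (One :: w) = (weight w).+1.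
Proof. by rewrite /weight big_cons. Qed.

Lemma weight_Two (w : fword) : weight (Two :: w) = (weight w).+2.
Proof. by rewrite /weight big_cons. Qed.

Lemma weight_nil : weight [::] = 0%N.
Proof. by rewrite /weight big_nil. Qed.

Lemma ones_cat (j k : nat) (w : fword) : ones (j + k) ++ w = ones j ++ (ones k ++ w).
Proof. by rewrite catA [ones (j + k)]nseqD. Qed.

Lemma weight_ones (k : nat) (w : fword) : weight (ones k ++ w) = (k + weight w)%N.
Proof. by elim: k => [//|k IH]; rewrite -/(One :: _) weight_One IH. Qed.

Lemma weight_upper_covers (v w : fword) : w \in upper_covers v -> weight w = (weight v).+1.
Proof. by move=> /upper_coversP /weight_covers. Qed.

Lemma weight_lower_covers (v w : fword) : v \in lower_covers w -> weight w = (weight v).+1.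
Proof. by rewrite mem_lower_covers; exact: weight_upper_covers. Qed.

(** * Counting chains of prescribed length *)

Fixpoint nchains (n : nat) (u v : fword) : nat :=
  match n with
  | 0 => u == v
  | n.+1 => \sum_(u' <- upper_covers u) nchains n u' v
  end.

Lemma sum_eq_mem (T : eqType) (s : seq T) (x : T) :
  uniq s -> (\sum_(y <- s) (y == x) = (x \in s))%N.
Proof.
move=> us; rewrite (eq_bigr (fun y => if y == x then 1 else 0)%N) => [|y _]; last first.
  by case: (y == x).
by rewrite -big_mkcond /= sum1_count -(count_uniq_mem x us).
Qed.

(** Chains may be cut at the last step instead of the first: exchange the two sums. *)
Lemma nchains_lower (n : nat) (u v : fword) :
  nchains n.+1 u v = (\sum_(v' <- lower_covers v) nchains n u v')%N.
Proof.
elim: n u v => [|n IH] u v.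
  rewrite /= sum_eq_mem ?(uniq_covers u).1//.
  under eq_bigr do rewrite eq_sym.
  by rewrite sum_eq_mem ?(uniq_covers v).2// mem_lower_covers.
rewrite [LHS]/=; under eq_bigr do rewrite -/(nchains n.+1 _ _) IH.
by rewrite exchange_big.
Qed.

Fixpoint chains (n : nat) (u v : fword) : seq (seq fword) :=
  match n with
  | 0 => if u == v then [:: [::]] else [::]
  | n.+1 => flatten [seq [seq u' :: s | s <- chains n u' v] | u' <- upper_covers u]
  end.

Lemma chainsP (n : nat) (u v : fword) (s : seq fword) :
  reflect ([/\ path (fun a b => `[< covers a b >]) u s, last u s = v & size s = n])
    (s \in chains n u v).
Proof.
elim: n u s => [|n IH] u s /=.
  case: eqVneq => [->|/eqP uv]; rewrite ?inE.
    by apply: (iffP eqP) => [-> //|[_ _ /eqP]]; rewrite size_eq0 => /eqP.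
  by apply: (iffP idP) => // -[] _ + /eqP; rewrite size_eq0 => + /eqP s0; rewrite s0.
apply: (iffP flatten_mapP) => [[u' uu' /mapP[r /IH[pr lr sr] ->]]|].
  by split => //=; [apply/andP; split => //; apply/asboolP/upper_coversP|rewrite sr].
case: s => [[]//|b s] [/= /andP[/asboolP ub pb] lb [sn]].
by exists b; [apply/upper_coversP|apply: map_f; apply/IH].
Qed.

Lemma uniq_chains (n : nat) (u v : fword) : uniq (chains n u v).
Proof.
elim: n u => [|n IH] u /=; first by case: eqVneq.
have := (uniq_covers u).1; elim: (upper_covers u) => [//|b s IHs] /= /andP[bs us].
rewrite cat_uniq IHs // andbT map_inj_uniq ?IH /=; last by move=> ? ? [].
apply/hasPn => r /flatten_mapP[b' b's /mapP[r' _ ->]].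
by apply/negP => /mapP[r'' _ [bb' _]]; rewrite -bb' b's in bs.
Qed.

Lemma size_chains (n : nat) (u v : fword) : size (chains n u v) = nchains n u v.
Proof.
elim: n u => [|n IH] u /=; first by case: eqVneq.
rewrite size_flatten /shape -map_comp sumnE big_map.
by apply: eq_bigr => u' _; rewrite /= size_map IH.
Qed.

(** Every cover raises the weight by one, so all saturated chains from [u] to [v] have the same
    length and [chains n u v] lists them without repetition. *)
Lemma dimE (u v : fword) (n : nat) :
  weight v = (weight u + n)%N -> dim u v = nchains n u v.
Proof.
move=> wn; rewrite /dim -size_chains.
have -> : saturated_chains u v = [set` chains n u v].
  apply/seteqP; split => s /=.
    move=> [ps ls]; apply/chainsP; split => //.
    by apply/eqP; rewrite -(eqn_add2l (weight u)) -(weight_chain ps) ls wn.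
  by move=> /chainsP[].
have -> : [set` chains n u v] = [set` [fset s in chains n u v]%fset].
  by apply/seteqP; split => s /=; rewrite inE.
by rewrite set_fsetK card_fseq undup_id // uniq_chains.
Qed.

Lemma below_weight (u v : fword) : below u v -> (weight u <= weight v)%N.
Proof. by move=> [s [ps <-]]; rewrite (weight_chain ps) leq_addr. Qed.

Lemma below_dim (u v : fword) : below u v <-> (0 < dim u v)%N.
Proof.
rewrite /dim cardfs_gt0; split.
  move=> [s hs]; apply/fset0Pn; exists s.
  by rewrite in_fset_set ?inE //; exact: finite_saturated_chains.
move=> /fset0Pn[s]; rewrite in_fset_set; last exact: finite_saturated_chains.
by rewrite inE => hs; exists s.
Qed.

Lemma dim_lt (u v : fword) : (weight v < weight u)%N -> dim u v = 0%N.
Proof.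
move=> h; apply/eqP; rewrite -leqn0 leqNgt; apply/negP => /below_dim.
by move=> /below_weight; rewrite leqNgt h.
Qed.

Lemma dim_weight_eq (u v : fword) : weight v = weight u -> dim u v = (u == v).
Proof. by move=> h; rewrite (@dimE _ _ 0) ?addn0. Qed.

Lemma dim_refl (u : fword) : dim u u = 1%N.
Proof. by rewrite dim_weight_eq // eqxx. Qed.

Lemma dim_upper (u v : fword) : (weight u < weight v)%N ->
  dim u v = (\sum_(u' <- upper_covers u) dim u' v)%N.
Proof.
move=> h; rewrite (@dimE _ _ (weight v - weight u).-1.+1); last lia.
rewrite /=; apply: eq_big_seq => u' /weight_upper_covers wu'.
by rewrite -dimE // wu'; lia.
Qed.

Lemma dim_lower (u v : fword) : (weight u < weight v)%N ->
  dim u v = (\sum_(v' <- lower_covers v) dim u v')%N.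
Proof.
move=> h; rewrite (@dimE _ _ (weight v - weight u).-1.+1); last lia.
rewrite nchains_lower; apply: eq_big_seq => v' /weight_lower_covers wv'.
by rewrite -dimE //; lia.
Qed.

(** The only lower cover of [One :: v] is [v], so every chain from a lighter word passes through
    [v]. *)
Lemma dim_One (u v : fword) : (weight u <= weight v)%N -> dim u (One :: v) = dim u v.
Proof. by move=> h; rewrite dim_lower ?weight_One // big_seq1. Qed.

Lemma dim_ones (u v : fword) (k : nat) : (weight u <= weight v)%N ->
  dim u (ones k ++ v) = dim u v.
Proof.
move=> h; elim: k => [//|k IH]; rewrite -[ones k.+1 ++ v]/(One :: (ones k ++ v)) dim_One ?IH //.
by rewrite weight_ones (leq_trans h) // leq_addl.
Qed.

(** This makes the functions of the paths [1^oo w] independent of the number of 1s chosen. *)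
Lemma dim_stable (u w : fword) (j k : nat) : (weight u <= j + weight w)%N ->
  (weight u <= k + weight w)%N -> dim u (ones j ++ w) = dim u (ones k ++ w).
Proof.
wlog jk : j k / (j <= k)%N => [hw hj hk|hj hk].
  by case/orP: (leq_total j k) => h; [|symmetry]; apply: hw.
by rewrite -(subnK jk) ones_cat [RHS]dim_ones // weight_ones.
Qed.

Lemma dim_nil_gt0 (w : fword) : (0 < dim [::] w)%N.
Proof.
have [n] := ubnP (weight w); elim: n w => // n IH [|[] w] wn.
- by rewrite dim_refl.
- by rewrite dim_One ?weight_nil // IH // -ltnS -weight_One.
rewrite dim_lower ?weight_Two ?weight_nil //= upper_coversE big_cons.
rewrite dim_One ?weight_nil // addn_gt0 IH //.
by rewrite -ltnS (leq_trans _ wn) // weight_Two ltnS leqnSn.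
Qed.

(* The Young-Fibonacci lattice is a 1-differential poset. *)
Lemma dim_Two (w : fword) : dim [::] (Two :: w) = ((weight w).+1 * dim [::] w)%N.
Proof.
have [n] := ubnP (weight w); elim: n w => // n IH w wn.
rewrite dim_lower ?weight_Two ?weight_nil //= upper_coversE big_cons big_map.
rewrite dim_One ?weight_nil // mulSn; congr (_ + _)%N.
(* A lower cover [v] of [w] has [(weight v).+1 = weight w], so induction gives each [Two :: v] the
   factor [weight w]. The remaining sum is [dim [::] w], or the factor is zero when [w] is empty. *)
rewrite (eq_big_seq (fun v => weight w * dim [::] v)%N) => [|v vw]; last first.
  by have e := weight_lower_covers vw; rewrite IH ?e // -ltnS -e.
rewrite -big_distrr /=; case: w {IH wn} => [|a w]; first by rewrite weight_nil.
by rewrite -dim_lower // weight_nil; case: a; rewrite ?weight_One ?weight_Two.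
Qed.

(** * Words of a given weight *)

Fixpoint level (n : nat) : seq fword :=
  match n with
  | 0 => [:: [::]]
  | n.+1 => [seq One :: w | w <- level n] ++
            (if n is m.+1 then [seq Two :: w | w <- level m] else [::])
  end.

Lemma levelP (n : nat) (w : fword) : (w \in level n) = (weight w == n).
Proof.
have nOT (u : fword) (s : seq fword) : (One :: u) \in [seq Two :: v | v <- s] = false.
  by apply/negP => /mapP[].
have nTO (u : fword) (s : seq fword) : (Two :: u) \in [seq One :: v | v <- s] = false.
  by apply/negP => /mapP[].
have iO : injective (cons One) by move=> ? ? [].
have iT : injective (cons Two) by move=> ? ? [].
elim/ltn_ind: n w => -[_|n IH] w.
  by rewrite inE; case: w => [|[] w]; rewrite ?weight_nil ?weight_One ?weight_Two.
rewrite /= mem_cat; case: w => [|[] w].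
- rewrite weight_nil; apply/negbTE/negP => /orP[/mapP[]//|].
  by case: n {IH} => //= n /mapP[].
- rewrite mem_map // IH // weight_One eqSS.
  by case: n {IH} => //= [|n]; rewrite ?nOT orbF.
- rewrite nTO weight_Two /=.
  by case: n IH => //= n IH; rewrite mem_map // IH // eqSS.
Qed.

Lemma uniq_level (n : nat) : uniq (level n).
Proof.
elim/ltn_ind: n => -[//|n IH] /=.
have iO : injective (cons One) by move=> ? ? [].
have iT : injective (cons Two) by move=> ? ? [].
rewrite cat_uniq map_inj_uniq // IH //=; case: n IH => //= n IH.
rewrite map_inj_uniq // IH // andbT.
by apply/hasPn => w /mapP[v _ ->]; apply/negP => /mapP[].
Qed.

(** A word of weight [n] is [1^n] or [1^(n-2-m) 2 w] with [w] of weight [m]; for [n < 2] the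
    truncated bound [n.-1] leaves the second sum empty. *)
Lemma big_level (V : nmodType) (f : fword -> V) (n : nat) :
  \sum_(w <- level n) f w = f (ones n) +
    \sum_(m < n.-1) \sum_(w <- level m) f (ones (n.-2 - m)%N ++ Two :: w).
Proof.
elim: n f => [|n IH] f; first by rewrite /= big_seq1 big_ord0 addr0.
rewrite [level _]/= big_cat big_map IH /= -addrA; congr (_ + _).
case: n {IH} => [|n] /=; first by rewrite big_nil !big_ord0 addr0.
rewrite big_ord_recr /= subnn big_map; congr (_ + _).
apply: eq_bigr => i _; apply: eq_bigr => w _.
by congr f; rewrite -[LHS]/(ones 1 ++ _) -ones_cat; congr (ones _ ++ _); have := ltn_ord i; lia.
Qed.

Lemma word_split (w : fword) :
  (exists k, w = ones k) \/ (exists k u, w = ones k ++ Two :: u).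
Proof.
elim: w => [|[] w IH]; first by left; exists 0%N.
  by case: IH => [[k ->]|[k [u ->]]]; [left; exists k.+1|right; exists k.+1, u].
by right; exists 0%N, w.
Qed.

Lemma ones_Two_inj (j k : nat) (v w : fword) :
  ones j ++ Two :: v = ones k ++ Two :: w -> j = k /\ v = w.
Proof. by elim: j k => [|j IH] [|k] //= [] // /IH[-> ->]. Qed.

(** * Harmonic functions *)

Section Harmonic.
Context {R : realType}.
Implicit Types (f g : fword -> R) (v w : fword).

Lemma harmonicP f :
  harmonic f <-> forall w, f w = \sum_(v <- upper_covers w) f v.
Proof.
have e w : \sum_(v \in [set v | covers w v]) f v = \sum_(v <- upper_covers w) f v.
  have -> : [set v | covers w v] = [set` upper_covers w].
    by apply/seteqP; split => v /upper_coversP.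
  by rewrite -(@fsbig_seq _ _ _ _ (upper_covers w)) ?(uniq_covers w).1.
by split => h w; rewrite [LHS]h e.
Qed.

Lemma harmonicD f g : harmonic f -> harmonic g -> harmonic (f \+ g).
Proof.
move=> /harmonicP hf /harmonicP hg; apply/harmonicP => w /=.
by rewrite big_split -hf -hg.
Qed.

Lemma harmonicZ a f : harmonic f -> harmonic (fun w => a * f w).
Proof. by move=> /harmonicP hf; apply/harmonicP => w; rewrite -mulr_sumr -hf. Qed.

Lemma harmonicB f g : harmonic f -> harmonic g -> harmonic (f \- g).
Proof.
move=> /harmonicP hf /harmonicP hg; apply/harmonicP => w /=.
by rewrite sumrB -hf -hg.
Qed.

Lemma harmonic_sum (I : Type) (s : seq I) (F : I -> fword -> R) :
  (forall i, harmonic (F i)) -> harmonic (fun w => \sum_(i <- s) F i w).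
Proof.
move=> hF; apply/harmonicP => w; rewrite exchange_big.
by apply: eq_bigr => i _; exact/(harmonicP (F i)).1.
Qed.

(** Harmonicity is iterated [n - weight v] times; the coefficients count the chains. *)
Lemma harmonic_level f v n : harmonic f -> (weight v <= n)%N ->
  f v = \sum_(u <- level n) (dim v u)%:R * f u.
Proof.
move=> /harmonicP hf vn; move e : (n - weight v)%N => d.
elim: d v vn e => [|d IH] v vn e.
  have vl : v \in level n by rewrite levelP; lia.
  rewrite (bigD1_seq v) ?uniq_level //= dim_refl mul1r big_seq_cond big1 ?addr0 //.
  move=> u /andP[]; rewrite levelP => /eqP wu uv.
  by rewrite dim_weight_eq ?wu; [rewrite eq_sym (negbTE uv) mul0r|lia].
rewrite hf big_seq; under eq_bigr => u /weight_upper_covers wu.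
  rewrite (IH u); [over|lia|lia].
rewrite -big_seq exchange_big /=; apply: eq_big_seq => u; rewrite levelP => /eqP un.
by rewrite dim_upper ?un; [rewrite natr_sum mulr_suml|lia].
Qed.

(** * Nonnegative harmonic functions are largest at the root *)

Section Nonnegative.
Variable f : fword -> R.
Hypotheses (f_ge0 : forall w, 0 <= f w) (f_harm : harmonic f).

Lemma dim_harmonic_le v u : (dim v u)%:R * f u <= f v.
Proof.
case: (ltnP (weight u) (weight v)) => uv; first by rewrite dim_lt ?mul0r.
rewrite [leRHS](harmonic_level f_harm uv) (bigD1_seq u) ?uniq_level ?levelP //=.
by rewrite lerDl sumr_ge0 // => i _; rewrite mulr_ge0.
Qed.

Lemma harmonic_le_nil v : f v <= f [::].
Proof.
apply: le_trans (dim_harmonic_le [::] v).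
by rewrite ler_peMl // ler1n dim_nil_gt0.
Qed.

End Nonnegative.

(** The difference is nonnegative harmonic and zero at the root, where it is largest. *)
Lemma harmonic_dominated f g : harmonic f -> harmonic g ->
  (forall w, f w <= g w) -> f [::] = g [::] -> f = g.
Proof.
move=> hf hg fg e; apply/funext => w.
have h0 u : 0 <= (g \- f) u by rewrite /= subr_ge0.
have := harmonic_le_nil h0 (harmonicB hg hf) w.
by rewrite /= e subrr subr_le0 => gf; apply/eqP; rewrite eq_le fg.
Qed.

(* The function of the path [1^oo w]: [Phi1] for [w] empty, [Phi12 u] for [w = 2u]. *)
Definition Phi_ones w v : R :=
  (dim v (ones (weight v) ++ w))%:R / (dim [::] w)%:R.

Lemma Phi_onesE w v k : (weight v <= k + weight w)%N ->
  Phi_ones w v = (dim v (ones k ++ w))%:R / (dim [::] w)%:R.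
Proof. by move=> h; rewrite /Phi_ones (@dim_stable _ _ (weight v) k) // leq_addr. Qed.

Lemma dim_nil_neq0 w : (dim [::] w)%:R != 0 :> R.
Proof. by rewrite pnatr_eq0 -lt0n dim_nil_gt0. Qed.

(** The target [1^(weight v)] has the weight of [v], so the dimension is 1 or 0 according to whether
    the two words agree. *)
Lemma Phi1E : @Phi1 R = Phi_ones [::].
Proof.
apply/funext => v; rewrite /Phi_ones dim_refl divr1 /Phi1 dim_weight_eq; last first.
  by rewrite weight_ones weight_nil addn0.
rewrite cats0; congr (nat_of_bool _)%:R; apply/asboolP/eqP => [[k ->]|->].
  by rewrite -{2}[ones k]cats0 weight_ones weight_nil addn0.
by eexists.
Qed.

(** A [k] selected by [xget] puts [v] below the target, hence is large enough for the dimension to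
    be stable; if there is none, the dimension is zero. *)
Lemma Phi12E w : @Phi12 R w = Phi_ones (Two :: w).
Proof.
apply/funext => v; rewrite /Phi12; case: ifPn => [/asboolP|/asboolPn] hK.
  have [k hk] := hK.
  rewrite (Phi_onesE (k := xget 0%N [set k | below v (ones k ++ Two :: w)])) //.
  rewrite -weight_ones; apply: below_weight.
  exact: (xgetPex 0%N hK).
rewrite /Phi_ones; case: (posnP (dim v (ones (weight v) ++ Two :: w))) => [->|/below_dim h].
  by rewrite mul0r.
by exfalso; apply: hK; eexists; exact: h.
Qed.

Lemma Phi_ones_ge0 w v : 0 <= Phi_ones w v.
Proof. by rewrite divr_ge0. Qed.

Lemma Phi_ones_nil w : Phi_ones w [::] = 1.
Proof. by rewrite (Phi_onesE (k := 0)) ?weight_nil // divff // dim_nil_neq0. Qed.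

Lemma Phi_ones_harmonic w : harmonic (Phi_ones w).
Proof.
(* One more 1 than [v] requires, so that the same target also serves all covers of [v]. *)
apply/harmonicP => v; rewrite (Phi_onesE (k := (weight v).+1)); last lia.
rewrite dim_upper ?weight_ones; last lia.
rewrite natr_sum mulr_suml; apply: eq_big_seq => u /weight_upper_covers wu.
by rewrite (Phi_onesE (k := (weight v).+1)) // wu leq_addr.
Qed.

Lemma Phi_ones_normalized w : normalized_nonneg_harmonic (Phi_ones w).
Proof.
by split; [exact: Phi_ones_ge0|exact: Phi_ones_nil|exact: Phi_ones_harmonic].
Qed.

(** Since [1^n w] and [w] have the same dimension, this is the coherent weight of [1^n w]. *)
Definition tail_seq f w : R^nat := fun n => (dim [::] w)%:R * f (ones n ++ w).

Definition tail_mass f w : R := limn (tail_seq f w).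

(** * Tail masses and the expansion along the paths [1^oo w] *)

Section TailMass.
Variable f : fword -> R.
Hypotheses (f_ge0 : forall w, 0 <= f w) (f_harm : harmonic f).

Lemma tail_seq_ge0 w n : 0 <= tail_seq f w n.
Proof. by rewrite mulr_ge0. Qed.

Lemma tail_seq_le_nil w n : tail_seq f w n <= f [::].
Proof.
rewrite /tail_seq -(@dim_ones [::] w n) ?weight_nil //; exact: dim_harmonic_le.
Qed.

(** The word [1^(n+1) w] is one of the covers of [1^n w], and the other covers contribute
    nonnegatively. *)
Lemma tail_seq_nonincreasing w : nonincreasing_seq (tail_seq f w).
Proof.
apply/nonincreasing_seqP => n; rewrite ler_wpM2l //.
rewrite [leRHS]((harmonicP f).1 f_harm) upper_coversE big_cons lerDl.
by rewrite sumr_ge0.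
Qed.

Lemma cvg_tail_seq w : cvgn (tail_seq f w).
Proof.
apply: nonincreasing_is_cvgn; first exact: tail_seq_nonincreasing.
by exists 0 => _ [n _ <-]; exact: tail_seq_ge0.
Qed.

Lemma tail_mass_le w n : tail_mass f w <= tail_seq f w n.
Proof.
apply: nonincreasing_cvgn_ge; [exact: tail_seq_nonincreasing|exact: cvg_tail_seq].
Qed.

Lemma tail_mass_ge0 w : 0 <= tail_mass f w.
Proof.
by apply: limr_ge; [exact: cvg_tail_seq|apply: nearW => n; exact: tail_seq_ge0].
Qed.

(** The bound involves the single word [1^n w], so bounds for different [w] can be added within one
    level. *)
Lemma tail_mass_Phi_le_dim w v n : (weight v <= n + weight w)%N ->
  tail_mass f w * Phi_ones w v <= (dim v (ones n ++ w))%:R * f (ones n ++ w).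
Proof.
move=> vw; rewrite (Phi_onesE vw) mulrCA ler_wpM2l // ler_pdivrMr; last first.
  by rewrite ltr0n dim_nil_gt0.
by rewrite [leRHS]mulrC; exact: tail_mass_le.
Qed.

Lemma tail_mass_Phi_le w v : tail_mass f w * Phi_ones w v <= f v.
Proof.
have h : (weight v <= weight v + weight w)%N by rewrite leq_addr.
exact: le_trans (tail_mass_Phi_le_dim h) (dim_harmonic_le f_ge0 f_harm _ _).
Qed.

Definition partial_expansion (K : nat) v : R :=
  tail_mass f [::] * Phi_ones [::] v +
  \sum_(m < K) \sum_(w <- level m) tail_mass f (Two :: w) * Phi_ones (Two :: w) v.

(** Expand [f v] over one level: each term of the partial expansion is bounded by the contribution
    of its own word there, and the other words contribute nonnegatively. *)
Lemma partial_expansion_le K v : partial_expansion K v <= f v.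
Proof.
(* At this level [big_level] has [K + weight v] inner sums, of which the first [K] match the partial
   expansion. *)
have vN : (weight v <= (K + weight v).+1)%N by lia.
rewrite [leRHS](harmonic_level f_harm vN) big_level; apply: lerD.
  have /(@tail_mass_Phi_le_dim [::]) : (weight v <= (K + weight v).+1 + weight [::])%N.
    by rewrite weight_nil addn0.
  by rewrite cats0.
rewrite big_split_ord /= -[leLHS]addr0; apply: lerD; last first.
  by do 2!(apply: sumr_ge0 => ? _); rewrite mulr_ge0.
apply: ler_sum => m _; rewrite big_seq [leRHS]big_seq; apply: ler_sum => w.
rewrite levelP => /eqP wm; apply: tail_mass_Phi_le_dim; rewrite weight_Two wm.
by have := ltn_ord m; lia.
Qed.

Lemma harmonic_partial_expansion K : harmonic (partial_expansion K).
Proof.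
apply: harmonicD; first exact/harmonicZ/Phi_ones_harmonic.
apply: harmonic_sum => m; apply: harmonic_sum => w.
exact/harmonicZ/Phi_ones_harmonic.
Qed.

(* [f] minus a partial expansion is nonnegative harmonic, so largest at the root. *)
Lemma partial_expansion_ge K v :
  f v - (f [::] - partial_expansion K [::]) <= partial_expansion K v.
Proof.
have h0 u : 0 <= (f \- partial_expansion K) u.
  by rewrite /= subr_ge0 partial_expansion_le.
have := harmonic_le_nil h0 (harmonicB f_harm (harmonic_partial_expansion K)) v.
by rewrite /=; lra.
Qed.

(** The error at [v] is at most the error at the root. *)
Lemma cvg_partial_expansion v :
  partial_expansion ^~ [::] @ \oo --> f [::] -> partial_expansion ^~ v @ \oo --> f v.
Proof.
move=> h; apply: (@squeeze_cvgr _ _ _ _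
    (fun K => f v - (f [::] - partial_expansion K [::])) (cst (f v))).
- by apply: nearW => K; rewrite partial_expansion_ge partial_expansion_le.
- rewrite -[X in _ --> X]subr0 -(subrr (f [::])).
  by apply: cvgB; [exact: cvg_cst|apply: cvgB; [exact: cvg_cst|exact: h]].
- exact: cvg_cst.
Qed.

End TailMass.

(** * Extremality of the path functions *)

Lemma tail_seq_Phi_ones w n : tail_seq (Phi_ones w) w n = 1.
Proof.
rewrite /tail_seq (Phi_onesE (k := n)) ?weight_ones // dim_refl mulrCA mul1r divff //.
exact: dim_nil_neq0.
Qed.

Lemma tail_mass_Phi_ones w : tail_mass (Phi_ones w) w = 1.
Proof.
rewrite /tail_mass (_ : tail_seq _ _ = cst 1) ?lim_cst//.
by apply/funext => n; rewrite tail_seq_Phi_ones.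
Qed.

(** Here [f] dominates [Phi_ones w], with equality at the root. *)
Lemma eq_Phi_ones f w : normalized_nonneg_harmonic f ->
  (forall n, 1 <= tail_seq f w n) -> f = Phi_ones w.
Proof.
move=> [f0 f1 hf] h; symmetry; apply: harmonic_dominated => //.
- exact: Phi_ones_harmonic.
- move=> v; apply: le_trans (tail_mass_Phi_le f0 hf w v).
  rewrite ler_peMl ?Phi_ones_ge0 //.
  by apply: limr_ge; [exact: cvg_tail_seq|exact: nearW].
- by rewrite Phi_ones_nil f1.
Qed.

(** Weights along [1^n w] are at most 1 for normalized functions and equal 1 for [Phi_ones w]. In a
    convex decomposition both parts must then attain 1, which identifies them. *)
Lemma Phi_ones_extremal w : extremal (Phi_ones w).
Proof.
split; first exact: Phi_ones_normalized.
move=> f g p hf hg /andP[p0 p1] e.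
have le1 h n : normalized_nonneg_harmonic h -> tail_seq h w n <= 1.
  by move=> [h0 <- hh]; exact: tail_seq_le_nil.
have H n : 1 <= tail_seq f w n /\ 1 <= tail_seq g w n.
  have := le1 _ n hf; have := le1 _ n hg.
  have : 1 = p * tail_seq f w n + (1 - p) * tail_seq g w n.
    rewrite -[LHS](tail_seq_Phi_ones w n) /tail_seq e; ring.
  by move=> *; split; nra.
by split; apply: eq_Phi_ones => // n; case: (H n).
Qed.

(** If [a < 1], then [f] is a proper convex combination of [g] and the normalized remainder; if
    [a = 1], domination with equality at the root suffices. *)
Lemma extremal_minorant f g a : extremal f -> normalized_nonneg_harmonic g ->
  0 < a -> (forall w, a * g w <= f w) -> f = g.
Proof.
move=> [[f0 f1 hf] fext] ng a0 agf; have [g0 g1 hg] := ng.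
have := agf [::]; rewrite f1 g1 mulr1 le_eqVlt => /predU1P[a1|a1].
  symmetry; apply: harmonic_dominated => //; last by rewrite f1 g1.
  by move=> w; rewrite -[leLHS]mul1r -a1.
have a1' : 1 - a != 0 by rewrite subr_eq0 eq_sym lt_eqF.
have nh : normalized_nonneg_harmonic (fun w => (1 - a)^-1 * (f w - a * g w)).
  split.
  - by move=> w; rewrite mulr_ge0 ?invr_ge0 ?subr_ge0 // ltW.
  - by rewrite f1 g1 mulr1 mulVf.
  - by apply: harmonicZ; apply: harmonicB => //; exact: harmonicZ.
have [|w|-> //] := fext _ _ a ng nh; first by rewrite a0 a1.
by field.
Qed.

(** A positive mass makes a multiple of [Phi_ones w] a minorant of [f], which extremality forces to
    be [f] itself. *)
Lemma tail_mass_extremal f w : extremal f -> tail_mass f w = `[< f = Phi_ones w >]%:R.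
Proof.
move=> ef; have [[f0 f1 hf] _] := ef.
case: asboolP => [->|fw]; first by rewrite tail_mass_Phi_ones.
apply/eqP; rewrite eq_le tail_mass_ge0 // andbT leNgt; apply/negP => l0; apply: fw.
apply: extremal_minorant l0 _ => //; first exact: Phi_ones_normalized.
exact: tail_mass_Phi_le.
Qed.

(** At the word [1^(weight v) w] the right function is nonzero, while the left one vanishes unless
    this word is [1^(weight w) v], which has the same weight. *)
Lemma Phi_ones_word_eq v w : Phi_ones v = Phi_ones w ->
  ones (weight v) ++ w = ones (weight w) ++ v.
Proof.
move=> /(congr1 (fun f => f (ones (weight v) ++ w))).
rewrite [LHS](Phi_onesE (k := weight w)); last by rewrite weight_ones addnC.
rewrite [RHS](Phi_onesE (k := weight v)) ?weight_ones // dim_refl.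
rewrite dim_weight_eq ?weight_ones 1?addnC //; case: eqP => // _ /eqP.
by rewrite mul0r eq_sym mul1r invr_eq0 (negbTE (dim_nil_neq0 _)).
Qed.

Lemma Phi12_inj : injective (@Phi12 R).
Proof. by move=> v w; rewrite !Phi12E => /Phi_ones_word_eq /ones_Two_inj[]. Qed.

Lemma Phi12_neq_Phi1 w : @Phi12 R w <> @Phi1 R.
Proof.
rewrite Phi12E Phi1E => /Phi_ones_word_eq; rewrite weight_nil cats0 /ones weight_Two.
by [].
Qed.

End Harmonic.

(** * The clone harmonic function *)

Section Tridiagonal.
Context {R : realType}.
Implicit Types d u : nat -> R.

Lemma det_tridiag0 d u : \det (tridiag d u 0) = 1.
Proof. by rewrite det_mx00. Qed.

Lemma det_tridiag1 d u : \det (tridiag d u 1) = d 0%N.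
Proof. by rewrite det_mx11 mxE. Qed.

(** Expand along the last row; the minor of the subdiagonal 1 is then expanded along its last
    column, whose only nonzero entry is [u n]. *)
Lemma det_tridiagSS d u n : \det (tridiag d u n.+2) =
  d n.+1 * \det (tridiag d u n.+1) - u n * \det (tridiag d u n).
Proof.
have minor1 : row' ord_max (col' ord_max (tridiag d u n.+2)) = tridiag d u n.+1.
  by apply/matrixP => i j; rewrite !mxE !lift_max.
set k := widen_ord (leqnSn n.+1) (ord_max : 'I_n.+1).
have minor2 : \det (row' ord_max (col' k (tridiag d u n.+2))) =
    u n * \det (tridiag d u n).
  have lk : lift k (ord_max : 'I_n.+1) = n.+1 :> nat by rewrite /= /bump leqnn.
  rewrite (expand_det_col _ ord_max) big_ord_recr /= big1 ?add0r => [|i _].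
    rewrite !mxE lk !lift_max /= gtn_eqF ?eqxx //; congr (_ * _).
    rewrite /cofactor /= addnn -signr_odd odd_double mul1r; congr (\det _).
    apply/matrixP => i j; rewrite !mxE !lift_max /=.
    have bn : bump n j = j by rewrite /bump leqNgt ltn_ord.
    by rewrite bn bn.
  have i_n := ltn_ord i; rewrite !mxE lk !lift_max /= 2?gtn_eqF 1?ltn_eqF ?mul0r //; lia.
rewrite (expand_det_row _ ord_max) !big_ord_recr /= big1 ?add0r => [|i _].
  rewrite !mxE /= !eqxx /cofactor minor1 minor2 /= addnn addSn addnn.
  have sgn j : (-1) ^+ j.*2 = 1 :> R by rewrite -signr_odd odd_double.
  by rewrite exprS !sgn !ltn_eqF //; ring.
rewrite !mxE /=; have := ltn_ord i => lin.
by rewrite 2?ltn_eqF 1?gtn_eqF ?mul0r //; lia.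
Qed.

End Tridiagonal.

(** * Decreasing summable sequences and summation by parts *)

Section Sequences.
Context {R : realType}.
Implicit Types u : R^nat.

Lemma cvg_half u (l : R) : u @ \oo --> l -> (fun n => u n./2) @ \oo --> l.
Proof.
move=> ul; apply: (@cvg_comp _ _ _ half u \oo \oo) ul => A [N _ NA].
exists N.*2 => // n /= Nn; apply: NA => /=; rewrite -(half_bit_double N false) add0n.
exact: half_leq.
Qed.

(** The block of indices from [n./2] to [n] has at least [n/2] terms, each at least [u n], and its
    sum tends to zero. *)
Lemma cvg_natr_mul0 u (l : R) : nonincreasing_seq u -> (forall n, 0 <= u n) ->
  series u @ \oo --> l -> (fun n => n%:R * u n) @ \oo --> (0 : R).
Proof.
move=> ud u0 ul; apply: (@squeeze_cvgr _ _ _ _ (cst 0)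
    (fun n => 2 * (series u n - series u n./2))).
- apply: nearW => n; rewrite mulr_ge0 //= sub_series_geq; last first.
    by rewrite -divn2 leq_div.
  have : \sum_(n./2 <= i < n) u n <= \sum_(n./2 <= i < n) u i.
    rewrite big_nat [leRHS]big_nat; apply: ler_sum => i /andP[_ /ltnW]; exact: ud.
  rewrite sumr_const_nat -mulr_natl => h.
  have : n%:R <= 2 * (n - n./2)%:R :> R by rewrite -natrM ler_nat; lia.
  by have := u0 n; nra.
- exact: cvg_cst.
- rewrite -[X in _ --> X](mulr0 2) -(subrr l).
  by apply: cvgM; [exact: cvg_cst|apply: cvgB => //; exact: cvg_half].
Qed.

(** Summation by parts leaves the boundary term [K * u K], which vanishes in the limit. *)
Lemma cvg_abel_sum u (l : R) : nonincreasing_seq u -> (forall n, 0 <= u n) ->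
  series u @ \oo --> l ->
  (fun K => \sum_(m < K) m.+1%:R * (u m - u m.+1)) @ \oo --> l.
Proof.
move=> ud u0 ul.
have -> : (fun K => \sum_(m < K) m.+1%:R * (u m - u m.+1)) =
    series u \- (fun n => n%:R * u n).
  apply/funext => K /=; elim: K => [|K IH].
    by rewrite big_ord0 seriesEord /= big_ord0 mul0r subrr.
  by rewrite big_ord_recr /= IH seriesSr -natr1; ring.
by rewrite -[X in _ --> X]subr0; apply: cvgB => //; exact: cvg_natr_mul0 ul.
Qed.

End Sequences.

(** * The specialization with the factors [c] removed *)

Section Specialization.
Context {R : realType}.
Variable t : nat -> R.
Hypothesis t0 : t 0%N = 0.
Hypothesis t_gt0 : forall k : nat, (0 < k)%N -> 0 < t k.

Lemma t_ge0 k : 0 <= t k.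
Proof. by case: k => [|k]; [rewrite t0|exact/ltW/t_gt0]. Qed.

Definition Pprod (n : nat) : R := \prod_(i < n) (1 + t i).

Lemma PprodS n : Pprod n.+1 = Pprod n * (1 + t n).
Proof. by rewrite /Pprod big_ord_recr. Qed.

Lemma Pprod_gt0 n : 0 < Pprod n.
Proof. by apply: prodr_gt0 => i _; rewrite ltr_wpDr ?t_ge0. Qed.

Lemma Pprod_ge0 n : 0 <= Pprod n.
Proof. exact/ltW/Pprod_gt0. Qed.

Lemma Ainf_series0 m : Ainf_series t m 0 = 0.
Proof. by rewrite /Ainf_series seriesEord /= big_ord0. Qed.

Lemma Ainf_seriesSr m k :
  Ainf_series t m k.+1 = Ainf_series t m k + \prod_(m <= i < m + k.+1) t i.
Proof. exact: seriesSr. Qed.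

Lemma Ainf_seriesS m k : Ainf_series t m k.+1 = t m * (1 + Ainf_series t m.+1 k).
Proof.
elim: k => [|k IH].
  by rewrite Ainf_seriesSr !Ainf_series0 add0r addr0 mulr1 addn1 big_nat1.
rewrite Ainf_seriesSr IH Ainf_seriesSr big_ltn; last by rewrite addnS ltnS leq_addr.
by rewrite addSnnS; ring.
Qed.

(** Consecutive increments have ratio [t (m + k.+1)]; the resulting three-term recurrence is the one
    satisfied by the determinants after division by the [c] factors. *)
Lemma Ainf_seriesSS m k :
  Ainf_series t m k.+2 = (1 + t (m + k.+1)%N) * Ainf_series t m k.+1
                         - t (m + k.+1)%N * Ainf_series t m k.
Proof.
rewrite (Ainf_seriesSr m k.+1) addnS big_nat_recr /=; last by rewrite leq_addr.
rewrite (_ : \prod_(m <= i < m + k.+1) t i = Ainf_series t m k.+1 - Ainf_series t m k).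
  ring.
by rewrite Ainf_seriesSr; ring.
Qed.

Lemma Ainf_series_nondecreasing m : nondecreasing_seq (Ainf_series t m).
Proof.
apply/nondecreasing_seqP => k; rewrite Ainf_seriesSr lerDl.
by apply: prodr_ge0 => i _; exact: t_ge0.
Qed.

(* [cloneB] divided by [c (m+1) * ... * c (m+k+2)]. *)
Definition Bnorm (k m : nat) : R :=
  Ainf_series t m.+1 k.+1 - (1 + t m) * Ainf_series t m.+2 k.

Lemma BnormE k m : Bnorm k m = t m.+1 + (t m.+1 - t m - 1) * Ainf_series t m.+2 k.
Proof. by rewrite /Bnorm Ainf_seriesS; ring. Qed.

Lemma Bnorm0 m : Bnorm 0 m = t m.+1.
Proof. by rewrite BnormE Ainf_series0 mulr0 addr0. Qed.

Lemma Bnorm1 m : Bnorm 1 m = t m.+1 + (t m.+1 - t m - 1) * t m.+2.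
Proof. by rewrite BnormE Ainf_seriesS Ainf_series0 addr0 mulr1. Qed.

Lemma BnormSS k m : Bnorm k.+2 m =
  (1 + t (m + k + 3)%N) * Bnorm k.+1 m - t (m + k + 3)%N * Bnorm k m.
Proof.
rewrite /Bnorm (Ainf_seriesSS m.+1 k.+1) (Ainf_seriesSS m.+2 k).
have -> : (m.+1 + k.+2 = m + k + 3)%N by lia.
have -> : (m.+2 + k.+1 = m + k + 3)%N by lia.
by ring.
Qed.

(** This is [clone_schur_rec] divided by its product of [c] factors; the determinants [cloneA]
    become 1. *)
Fixpoint norm_schur_rec (k : nat) (w : fword) : R :=
  match w with
  | [::] => 1
  | One :: v => norm_schur_rec k.+1 v
  | Two :: v => Bnorm k (weight v) * norm_schur_rec 0 v
  end.

Definition norm_schur (w : fword) : R := norm_schur_rec 0 w.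

Lemma norm_schur_ones k : norm_schur (ones k) = 1.
Proof.
have H j : norm_schur_rec j (ones k) = 1 by elim: k j => [//|k IH] j; exact: IH.
exact: H.
Qed.

Lemma norm_schur_Two k w :
  norm_schur (ones k ++ Two :: w) = Bnorm k (weight w) * norm_schur w.
Proof.
have H j : norm_schur_rec j (ones k ++ Two :: w) =
    Bnorm (j + k) (weight w) * norm_schur w.
  by elim: k j => [|k IH] j; rewrite ?addn0 //= IH addSnnS.
exact: H.
Qed.

(* Harmonicity of the clone function, cleared of the denominators. *)
Lemma sum_norm_schur_upper w :
  \sum_(v <- upper_covers w) norm_schur v = (1 + t (weight w)) * norm_schur w.
Proof.
have [n] := ubnP (weight w); elim: n w => // n IH w wn.
rewrite upper_coversE big_cons big_map.
rewrite (eq_big_seq (fun v => t (weight w) * norm_schur v)) => [|v vw]; last first.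
  by rewrite (weight_lower_covers vw) (norm_schur_Two 0) Bnorm0.
(* Split [w] at its first 2. The empty word uses [t 0 = 0]. For [w = 2u] the lower covers are the
   upper covers of [u], handled by induction; for [w = 1^(k+1) 2 u] there is one lower cover and the
   claim is [BnormSS]. *)
rewrite -mulr_sumr; have [[k e]|[k [u e]]] := word_split w.
  rewrite e -[One :: _]/(ones k.+1) !norm_schur_ones; case: k e => [|k] e.
    by rewrite big_nil weight_nil t0 mulr0 !addr0 mulr1.
  by rewrite big_seq1 -/(ones k) norm_schur_ones; ring.
have wu : weight w = (weight u + k.+2)%N by rewrite e weight_ones weight_Two; lia.
rewrite {1 3 5}e -[One :: _]/(ones k.+1 ++ Two :: u) !norm_schur_Two.
case: k e wu => [|k] e wu.
  rewrite IH; last by lia.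
  by rewrite wu addn2 Bnorm0 Bnorm1; ring.
rewrite /= big_seq1 -/(ones k ++ _) norm_schur_Two BnormSS.
have -> : (weight u + k + 3 = weight w)%N by lia.
by ring.
Qed.

(** * The clone function in terms of [t] alone *)

Section Clone.
Variables x y c : nat -> R.
Hypothesis c_gt0 : forall k : nat, (0 < k)%N -> 0 < c k.
Hypothesis xE : forall k : nat, (0 < k)%N -> x k = c k * (1 + t k.-1).
Hypothesis yE : forall k : nat, (0 < k)%N -> y k = c k * c k.+1 * t k.

(** In the determinant recurrence the coefficients [1 + t] and [- t] add up to 1. The recurrence has
    order two, so consecutive values are proved in pairs. *)
Lemma cloneAE l : cloneA x y l = \prod_(1 <= i < l.+1) c i.
Proof.
suff [] : cloneA x y l = \prod_(1 <= i < l.+1) c i /\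
    cloneA x y l.+1 = \prod_(1 <= i < l.+2) c i by [].
elim: l => [|l [IH1 IH2]].
  by rewrite /cloneA det_tridiag0 det_tridiag1 big_nil xE // t0 addr0 mulr1 big_nat1.
split=> //; rewrite /cloneA det_tridiagSS -/(cloneA x y l) -/(cloneA x y l.+1).
rewrite IH1 IH2 xE // yE // (@big_nat_recr _ _ _ l.+2 1) // (@big_nat_recr _ _ _ l.+1 1) //=.
by ring.
Qed.

Lemma cloneBE k m :
  cloneB x y k m = \prod_(m.+1 <= i < (m + k.+3)%N) c i * Bnorm k m.
Proof.
have pS j : \prod_(m.+1 <= i < (m + j.+3)%N) c i =
    \prod_(m.+1 <= i < (m + j.+2)%N) c i * c (m + j.+2)%N.
  by rewrite (addnS _ j.+2) big_nat_recr //= -addSnnS leq_addr.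
suff [] : cloneB x y k m = \prod_(m.+1 <= i < (m + k.+3)%N) c i * Bnorm k m /\
    cloneB x y k.+1 m = \prod_(m.+1 <= i < (m + k.+4)%N) c i * Bnorm k.+1 m by [].
elim: k => [|k [IH1 IH2]].
  rewrite /cloneB det_tridiagSS det_tridiag1 det_tridiag0 /= Bnorm0 Bnorm1.
  rewrite !pS (addnS m 1) big_nat_recr //= ?addn1 // big_geq //.
  by rewrite addn2 addn3 !xE // !yE //=; split; ring.
split=> //; rewrite /cloneB det_tridiagSS -/(cloneB x y k m) -/(cloneB x y k.+1 m) /=.
rewrite IH1 IH2 BnormSS (pS k.+2) (pS k.+1).
have -> : (m + k.+2 + 2 = m + k.+4)%N by lia.
have -> : (m + k.+1 + 2 = m + k.+3)%N by lia.
rewrite xE ?yE; try lia.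
have -> : ((m + k.+4).-1 = m + k + 3)%N by lia.
have -> : ((m + k.+3).+1 = m + k.+4)%N by lia.
have -> : (m + k.+3 = m + k + 3)%N by lia.
by ring.
Qed.

Lemma clone_schur_recE k w : clone_schur_rec x y k w =
  \prod_(1 <= i < (k + weight w).+1) c i * norm_schur_rec k w.
Proof.
elim: w k => [|[] w IH] k /=; first by rewrite cloneAE weight_nil addn0 mulr1.
  by rewrite IH weight_One addSnnS.
rewrite IH cloneBE weight_Two add0n.
rewrite (@big_cat_nat _ _ _ (weight w).+1 _ (k + (weight w).+2).+1) //=; last lia.
have -> : (weight w + k.+3 = (k + (weight w).+2).+1)%N by lia.
by ring.
Qed.

(** The [c] factors of the Schur function cancel against those of [x 1 ... x n]. *)
Lemma clone_harmonicE w : clone_harmonic x y w = norm_schur w / Pprod (weight w).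
Proof.
rewrite /clone_harmonic /clone_schur clone_schur_recE add0n -/(norm_schur w).
have -> : \prod_(1 <= i < (weight w).+1) x i =
    \prod_(1 <= i < (weight w).+1) c i * Pprod (weight w).
  rewrite /Pprod big_add1 /= big_add1 /= !big_mkord -big_split.
  by apply: eq_bigr => i _; rewrite xE.
rewrite -mulf_div divff ?mul1r // gt_eqF //.
by rewrite big_nat_cond prodr_gt0 // => i; rewrite andbT => /andP[i0 _]; exact: c_gt0.
Qed.

Lemma harmonic_clone : harmonic (clone_harmonic x y).
Proof.
apply/harmonicP => w; under eq_big_seq => v /weight_upper_covers vw.
  by rewrite clone_harmonicE vw PprodS; over.
have p0 : 1 + t (weight w) != 0 by rewrite gt_eqF // ltr_wpDr ?t_ge0.
rewrite -mulr_suml sum_norm_schur_upper clone_harmonicE.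
by field; rewrite p0 gt_eqF ?Pprod_gt0.
Qed.

(** * Convergent type: positivity and limits *)

Hypothesis t_cvg : convergent_type t.

(** This is [Ainf t m] without its leading 1, for which the recursion in [m] is a plain product. *)
Definition Einf (m : nat) : R := limn (Ainf_series t m).

Lemma cvg_Ainf_series m : Ainf_series t m @ \oo --> Einf m.
Proof. exact: t_cvg.1. Qed.

Lemma EinfS m : Einf m = t m * (1 + Einf m.+1).
Proof.
apply: cvg_lim => //; rewrite -cvg_shiftS /=.
under eq_fun do rewrite Ainf_seriesS.
by apply: cvgM; [exact: cvg_cst|apply: cvgD; [exact: cvg_cst|exact: cvg_Ainf_series]].
Qed.

Lemma Ainf_series_le m k : Ainf_series t m k <= Einf m.
Proof.
apply: nondecreasing_cvgn_le; first exact: Ainf_series_nondecreasing.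
exact: t_cvg.1.
Qed.

Lemma Einf_ge0 m : 0 <= Einf m.
Proof. by rewrite -(Ainf_series0 m) Ainf_series_le. Qed.

Lemma BinfE m : Binf t m = t m.+1 + (t m.+1 - t m - 1) * Einf m.+2.
Proof. by rewrite /Binf /Ainf addn3 -/(Einf m.+3) (EinfS m.+2) mulrA. Qed.

Lemma cvg_Bnorm m : Bnorm ^~ m @ \oo --> Binf t m.
Proof.
rewrite BinfE; under eq_fun do rewrite BnormE.
apply: cvgD; first exact: cvg_cst.
by apply: cvgM; [exact: cvg_cst|exact: cvg_Ainf_series].
Qed.

(** Depending on the sign of [t m.+1 - t m - 1], either all terms are nonnegative, or [Bnorm k m] is
    at least its limit [Binf t m]. *)
Lemma Bnorm_ge0 k m : 0 <= Bnorm k m.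
Proof.
rewrite BnormE; have [h|h] := leP 0 (t m.+1 - t m - 1).
  by rewrite addr_ge0 ?t_ge0 // mulr_ge0 // -(Ainf_series0 m.+2) Ainf_series_nondecreasing.
apply: le_trans (t_cvg.2 m) _; rewrite BinfE lerD2l ler_wnM2l ?Ainf_series_le //.
exact: ltW.
Qed.

Lemma norm_schur_ge0 w : 0 <= norm_schur w.
Proof.
rewrite /norm_schur; elim: w (0%N) => [|[] w IH] k //=.
by rewrite mulr_ge0 ?Bnorm_ge0.
Qed.

Lemma clone_harmonic_ge0 w : 0 <= clone_harmonic x y w.
Proof. by rewrite clone_harmonicE divr_ge0 ?norm_schur_ge0 // Pprod_ge0. Qed.

Lemma clone_harmonic_nil : clone_harmonic x y [::] = 1.
Proof. by rewrite clone_harmonicE weight_nil /Pprod big_ord0 divr1. Qed.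

Lemma muIE w : muI x y w = tail_mass (clone_harmonic x y) w.
Proof.
congr (limn _); apply/funext => n.
by rewrite /coherent_measure /tail_seq dim_ones // weight_nil.
Qed.

Hypothesis muI_gt0 : 0 < muI x y [::].

(** * Total Type-I mass of the clone function *)

Let a := muI x y [::].

(** The clone function takes the value [1 / Pprod k] at [1^k]. The shift [n] is for words that end
    in a fixed suffix. *)
Lemma cvg_Pprod_inv n : (fun k => (Pprod (k + n))^-1) @ \oo --> a.
Proof.
rewrite (cvg_shiftn n (fun k => (Pprod k)^-1)) /a muIE.
suff -> : (fun k => (Pprod k)^-1) = tail_seq (clone_harmonic x y) [::].
  by apply: cvg_tail_seq; [exact: clone_harmonic_ge0|exact: harmonic_clone].
apply/funext => k; rewrite /tail_seq dim_refl mul1r cats0 clone_harmonicE.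
by rewrite norm_schur_ones mul1r -[ones k]cats0 weight_ones weight_nil addn0.
Qed.

Lemma cvg_Pprod : Pprod @ \oo --> a^-1.
Proof.
have -> : Pprod = fun k => ((Pprod (k + 0))^-1)^-1.
  by apply/funext => k; rewrite addn0 invrK.
exact: cvgV (lt0r_neq0 muI_gt0) (cvg_Pprod_inv 0).
Qed.

Lemma Pprod_nondecreasing : nondecreasing_seq Pprod.
Proof.
apply/nondecreasing_seqP => n; rewrite PprodS ler_peMr ?Pprod_ge0 //.
by rewrite lerDl t_ge0.
Qed.

Lemma Pprod_le n : Pprod n <= a^-1.
Proof.
rewrite -(cvg_lim _ cvg_Pprod) //.
apply: nondecreasing_cvgn_le; first exact: Pprod_nondecreasing.
by apply/cvg_ex; eexists; exact: cvg_Pprod.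
Qed.

(** Passing to [n.+1] multiplies the old sum by [t n.+1] and adds [Pprod n.+1], just as [PprodS]
    does. *)
Lemma sum_Pprod_prod n :
  \sum_(m < n.+1) Pprod m * \prod_(m.+1 <= i < n.+1) t i = Pprod n.+1.
Proof.
elim: n => [|n IH].
  by rewrite big_ord_recr big_ord0 /= add0r big_geq // PprodS t0 addr0.
rewrite big_ord_recr /= (@big_geq _ _ _ n.+2) // mulr1 (PprodS n.+1) mulrDr mulr1.
rewrite addrC; congr (_ + _); rewrite -IH mulr_suml; apply: eq_bigr => m _.
by rewrite -mulrA; congr (_ * _); rewrite big_nat_recr //= ltnS -ltnS.
Qed.

(** A finite form of the sum of [Gseq], with all products cut at index [n]; the increment in [n] is
    [t n.+1 * Pprod n.+1]. *)
Lemma sum_Pprod_Ainf n :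
  \sum_(m < n.+1) Pprod m * Ainf_series t m.+1 (n - m)%N = Pprod n.+1 - 1.
Proof.
elim: n => [|n IH].
  rewrite big_ord_recr big_ord0 /= add0r Ainf_series0 mulr0 PprodS t0 addr0 mulr1.
  by rewrite /Pprod big_ord0 subrr.
rewrite big_ord_recr /= subnn Ainf_series0 mulr0 addr0.
transitivity (\sum_(m < n.+1) (Pprod m * Ainf_series t m.+1 (n - m)%N +
    t n.+1 * (Pprod m * \prod_(m.+1 <= i < n.+1) t i))).
  apply: eq_bigr => m _; have mn : (m <= n)%N by rewrite -ltnS.
  rewrite subSn // Ainf_seriesSr (_ : (m.+1 + (n - m).+1 = n.+2)%N); last lia.
  by rewrite big_nat_recr //=; ring.
by rewrite big_split /= IH -mulr_sumr sum_Pprod_prod (PprodS n.+1); ring.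
Qed.

Definition Gseq (m : nat) : R := Pprod m * Einf m.+1.

Lemma Gseq_ge0 m : 0 <= Gseq m.
Proof. by rewrite mulr_ge0 ?Einf_ge0 // Pprod_ge0. Qed.

Lemma GseqB m : Gseq m - Gseq m.+1 = Pprod m * Binf t m.
Proof. by rewrite /Gseq PprodS (EinfS m.+1) BinfE; ring. Qed.

Lemma Gseq_nonincreasing : nonincreasing_seq Gseq.
Proof.
apply/nonincreasing_seqP => m; rewrite -subr_ge0 GseqB mulr_ge0 ?t_cvg.2 //.
exact: Pprod_ge0.
Qed.

(** Cut products give the lower bound. For the upper bound, fix [K], cut each series after [j]
    terms, compare with a longer finite identity, and let [j] grow. *)
Lemma cvg_series_Gseq : series Gseq @ \oo --> a^-1 - 1.
Proof.
have lower n : Pprod n - 1 <= series Gseq n.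
  rewrite seriesEord; case: n => [|n] /=; first by rewrite /Pprod !big_ord0 subrr.
  rewrite -sum_Pprod_Ainf; apply: ler_sum => m _.
  by rewrite ler_wpM2l ?Ainf_series_le // Pprod_ge0.
have upper K : series Gseq K <= a^-1 - 1.
  rewrite seriesEord /=.
  have cS : (fun j => \sum_(m < K) Pprod m * Ainf_series t m.+1 j) @ \oo -->
      \sum_(m < K) Gseq m.
    apply: cvg_big => [|m _]; first exact: add_continuous.
    by apply: cvgM; [exact: cvg_cst|exact: cvg_Ainf_series].
  rewrite -(cvg_lim _ cS) //; apply: limr_le; first by apply/cvg_ex; eexists; exact: cS.
  (* With [n = j + K], every [m < K] keeps at least [j] terms, since [n - m >= j]. *)
  apply: nearW => j; apply: le_trans (lerB (Pprod_le (j + K).+1) (lexx 1)).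
  rewrite -sum_Pprod_Ainf (_ : (j + K).+1 = (K + j.+1)%N) ?big_split_ord /=; last lia.
  rewrite -[leLHS]addr0; apply: lerD; last first.
    apply: sumr_ge0 => m _; rewrite mulr_ge0 ?Pprod_ge0 //.
    by rewrite -(Ainf_series0 (K + m).+1) Ainf_series_nondecreasing.
  apply: ler_sum => m _; rewrite ler_wpM2l ?Pprod_ge0 //.
  by apply: Ainf_series_nondecreasing; have := ltn_ord m; lia.
apply: (@squeeze_cvgr _ _ _ _ (fun n => Pprod n - 1) (cst (a^-1 - 1))).
- by apply: nearW => n; rewrite lower upper.
- by apply: cvgB; [exact: cvg_Pprod|exact: cvg_cst].
- exact: cvg_cst.
Qed.

(** The factor for the leading [1^n 2] tends to [Binf], and the inverse of [Pprod] to [a]. What is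
    left is the coherent weight of [w], multiplied by [(weight w).+1] from [dim_Two]. *)
Lemma muI_Two w : muI x y (Two :: w) =
  (weight w).+1%:R * (Pprod (weight w) * Binf t (weight w)) * a *
  ((dim [::] w)%:R * clone_harmonic x y w).
Proof.
rewrite muIE; apply: cvg_lim => //.
have -> : tail_seq (clone_harmonic x y) (Two :: w) = fun n =>
    (dim [::] (Two :: w))%:R * norm_schur w *
    (Bnorm n (weight w) * (Pprod (n + (weight w).+2))^-1).
  apply/funext => n; rewrite /tail_seq clone_harmonicE norm_schur_Two weight_ones.
  by rewrite weight_Two; ring.
have -> : (weight w).+1%:R * (Pprod (weight w) * Binf t (weight w)) * a *
    ((dim [::] w)%:R * clone_harmonic x y w) =
    (dim [::] (Two :: w))%:R * norm_schur w * (Binf t (weight w) * a).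
  rewrite dim_Two natrM clone_harmonicE; field.
  by rewrite gt_eqF ?Pprod_gt0.
apply: cvgM; first exact: cvg_cst.
by apply: cvgM; [exact: cvg_Bnorm|exact: cvg_Pprod_inv].
Qed.

(** The masses at weight [m] are one constant times the coherent weights, which add up to the value
    1 at the root. *)
Lemma sum_level_muI m : \sum_(w <- level m) muI x y (Two :: w) =
  a * (m.+1%:R * (Gseq m - Gseq m.+1)).
Proof.
rewrite (eq_big_seq (fun w => m.+1%:R * (Pprod m * Binf t m) * a *
    ((dim [::] w)%:R * clone_harmonic x y w))) => [|w]; last first.
  by rewrite levelP muI_Two => /eqP ->.
rewrite -mulr_sumr -(harmonic_level (n := m) harmonic_clone) ?weight_nil //.
by rewrite clone_harmonic_nil GseqB; ring.
Qed.

Lemma cvg_sum_level_muI :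
  (fun K => \sum_(m < K) \sum_(w <- level m) muI x y (Two :: w)) @ \oo --> 1 - a.
Proof.
have -> : (fun K => \sum_(m < K) \sum_(w <- level m) muI x y (Two :: w)) =
    fun K => a * \sum_(m < K) m.+1%:R * (Gseq m - Gseq m.+1).
  apply/funext => K; rewrite mulr_sumr.
  by apply: eq_bigr => m _; rewrite sum_level_muI.
have -> : 1 - a = a * (a^-1 - 1) by rewrite mulrBr mulr1 divff // gt_eqF.
apply: cvgM; first exact: cvg_cst.
apply: cvg_abel_sum; [exact: Gseq_nonincreasing|exact: Gseq_ge0|].
exact: cvg_series_Gseq.
Qed.

Lemma cvg_partial_expansion_clone v :
  partial_expansion (clone_harmonic x y) ^~ v @ \oo --> clone_harmonic x y v.
Proof.
apply: cvg_partial_expansion;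
  [exact: clone_harmonic_ge0|exact: harmonic_clone|].
have -> : partial_expansion (clone_harmonic x y) ^~ [::] =
    fun K => a + \sum_(m < K) \sum_(w <- level m) muI x y (Two :: w).
  apply/funext => K; rewrite /partial_expansion Phi_ones_nil mulr1 -muIE.
  congr (_ + _); apply: eq_bigr => m _; apply: eq_bigr => w _.
  by rewrite Phi_ones_nil mulr1 muIE.
rewrite clone_harmonic_nil -[X in _ --> X](subrKC a).
by apply: cvgD; [exact: cvg_cst|exact: cvg_sum_level_muI].
Qed.

End Clone.
End Specialization.

(** * Representing measures *)

Section WordSums.
Context {R : realType}.

Lemma esum_words (g : fword -> \bar R) : (forall w, (0 <= g w)%E) ->
  (\esum_(w in [set: fword]) g w = \sum_(m <oo) \sum_(w <- level m) g w)%E.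
Proof.
move=> g0; have -> : [set: fword] = \bigcup_(m in [set: nat]) [set` level m].
  by apply/seteqP; split => w // _; exists (weight w) => //=; rewrite levelP.
rewrite esum_bigcupT //; last first.
  by move=> i j _ _ [w [/=]]; rewrite !levelP => /eqP <- /eqP <-.
rewrite nneseries_esumT => [|m]; last exact: sume_ge0.
apply: eq_esum => m _.
rewrite esum_fset //; last exact: finite_seq.
by symmetry; apply: fsbig_seq; exact: uniq_level.
Qed.

Lemma esum_words_cvg (g : fword -> R) (l : R) : (forall w, 0 <= g w) ->
  (fun K => \sum_(m < K) \sum_(w <- level m) g w) @ \oo --> l ->
  (\esum_(w in [set: fword]) (g w)%:E = l%:E)%E.
Proof.
move=> g0 h; rewrite esum_words => [|w]; last by rewrite lee_fin.
apply: cvg_lim => //.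
have -> : (fun n => \sum_(0 <= m < n) \sum_(w <- level m) (g w)%:E)%E =
    EFin \o (fun K => \sum_(m < K) \sum_(w <- level m) g w).
  apply/funext => n /=; rewrite big_mkord -sumEFin.
  by apply: eq_bigr => m _; rewrite sumEFin.
by apply: cvg_EFin => //; exact: nearW.
Qed.

End WordSums.

(** * Points of the boundary and measurability *)

Section Boundary.
Context {R : realType}.
Local Notation boundary := (extremal_boundary R).
Implicit Types (w v : fword) (om : boundary).

Lemma ext_fun_inj : injective (@ext_fun R).
Proof.
move=> [f hf] [g hg] /= fg; subst g; congr ExtremalBoundary; exact: Prop_irrelevance.
Qed.

Definition Phi_pt w : boundary := ExtremalBoundary (Phi_ones_extremal w).

(** [typeI_component] tests functions against the image of [A]; injectivity of [ext_fun] turns this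
    into membership of a boundary point. *)
Lemma indic_ext_fun (A : set boundary) w :
  \1_(@ext_fun R @` A) (Phi_ones w) = \1_A (Phi_pt w) :> R.
Proof.
rewrite !indicE; congr (nat_of_bool _)%:R; apply/idP/idP; rewrite !inE.
  by move=> [om Aom e]; rewrite (_ : Phi_pt w = om) //; exact: ext_fun_inj.
by move=> Aw; exists (Phi_pt w).
Qed.

Lemma measurable_eval w : measurable_fun setT (fun om : boundary => om w).
Proof.
move=> _ B mB; apply: sub_sigma_algebra; exists w => //; exists B => //.
Qed.

Lemma measurable_evalE w :
  measurable_fun setT (EFin \o (fun om : boundary => om w)).
Proof. by apply/measurable_EFinP; exact: measurable_eval. Qed.

Lemma ext_fun_ge0 om w : 0 <= om w.
Proof. by have [[]] := ext_funP om. Qed.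

(** Agreement with [f] is a countable intersection of conditions on single evaluations. *)
Lemma measurable_point (f : fword -> R) :
  measurable [set om : boundary | ext_fun om = f].
Proof.
rewrite (_ : [set om : boundary | _] =
    ~` \bigcup_w ((fun om : boundary => om w) @^-1` (~` [set f w]))).
  apply: measurableC; apply: countable_bigcupT_measurable => [|w]; first exact: countableP.
  rewrite -[_ @^-1` _]setTI; apply: measurable_eval => //.
  exact: measurableC (measurable_set1 _).
apply/seteqP; split => om /=.
  by move=> e [w _]; apply; rewrite /= e.
move=> h; apply/funext => w; apply: contrapT => ne.
by apply: h; exists w.
Qed.

(** * Existence and uniqueness of the representing measure *)

Section Represent.
Variable f : fword -> R.
Hypothesis nf : normalized_nonneg_harmonic f.

Let f0 : forall w, 0 <= f w. Proof. by case: nf. Qed.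
Let f1 : f [::] = 1. Proof. by case: nf. Qed.
Let fh : harmonic f. Proof. by case: nf. Qed.

(* On extremal functions [tail_mass _ w] is the indicator of [Phi_ones w]; integrate
   [tail_seq _ w n] against [nu] and let [n] tend to infinity. *)
Lemma represents_atom (nu : probability boundary R) w : represents nu f ->
  nu [set om | ext_fun om = Phi_ones w] = (tail_mass f w)%:E.
Proof.
move=> hnu; set S := [set om | _].
have int_tail n : (\int[nu]_om (tail_seq om w n)%:E)%E = (tail_seq f w n)%:E.
  under eq_integral do rewrite EFinM.
  rewrite ge0_integralZl_EFin //.
  - by rewrite -hnu.
  - by move=> om _; rewrite lee_fin ext_fun_ge0.
  - exact: measurable_evalE.
have cvg1 : (tail_seq f w n)%:E @[n --> \oo] --> (tail_mass f w)%:E.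
  apply: cvg_EFin; [exact: nearW|exact: cvg_tail_seq].
have cvg2 : (tail_seq f w n)%:E @[n --> \oo] --> nu S.
  rewrite -[S]setIT -integral_indic //; last exact: measurable_point.
  under eq_fun do rewrite -int_tail.
  (* The bound 1 is the value at the root of every extremal function. *)
  apply: (@dominated_cvg _ _ _ _ _ _ _ _ (EFin \o cst 1)) => //.
  - move=> n; under eq_fun do rewrite EFinM.
    by apply: measurable_funeM; exact: measurable_evalE.
  - move=> om _; rewrite indicE.
    have [[om0 om1 omh] _] := ext_funP om.
    have -> : (om \in S)%:R = tail_mass om w.
      rewrite tail_mass_extremal; last exact: ext_funP.
      by congr (nat_of_bool _)%:R; apply/idP/asboolP; rewrite inE.
    by apply: cvg_EFin; [exact: nearW|exact: cvg_tail_seq].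
  - exact: finite_measure_integrable_cst.
  - move=> n om _; have [[om0 om1 omh] _] := ext_funP om.
    rewrite /= lee_fin ger0_norm ?tail_seq_ge0 // -om1.
    exact: tail_seq_le_nil.
exact: cvg_unique cvg2 cvg1.
Qed.

Hypothesis f_total : partial_expansion f ^~ [::] @ \oo --> (1 : R).

Lemma cvg_Two_expansion v :
  (fun K => \sum_(m < K) \sum_(w <- level m) tail_mass f (Two :: w) * Phi_ones (Two :: w) v)
  @ \oo --> f v - tail_mass f [::] * Phi_ones [::] v.
Proof.
have h : partial_expansion f ^~ v @ \oo --> f v.
  by apply: cvg_partial_expansion; rewrite ?f1.
rewrite (_ : (fun K => _) =
    fun K => partial_expansion f K v - tail_mass f [::] * Phi_ones [::] v).
  by apply: cvgB => //; exact: cvg_cst.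
by apply/funext => K; rewrite /partial_expansion addrC addKr.
Qed.

Lemma esum_expansion v :
  (\esum_(w in [set: fword]) (tail_mass f (Two :: w) * Phi_ones (Two :: w) v)%:E =
   (f v - tail_mass f [::] * Phi_ones [::] v)%:E)%E.
Proof.
apply: esum_words_cvg; last exact: cvg_Two_expansion.
by move=> w; rewrite mulr_ge0 ?tail_mass_ge0 ?Phi_ones_ge0.
Qed.

Lemma harmonic_expansion v : ((f v)%:E =
  (tail_mass f [::] * Phi_ones [::] v)%:E +
  \esum_(w in [set: fword]) (tail_mass f (Two :: w) * Phi_ones (Two :: w) v)%:E)%E.
Proof. by rewrite esum_expansion -EFinD subrKC. Qed.

Definition atom w : {measure set boundary -> \bar R} :=
  mscale (NngNum (tail_mass_ge0 f0 fh w)) (\d_(Phi_pt w)).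

(** Finite sums of measures are indexed by integers, hence the words of weight [m] are taken by
    position. *)
Definition level_measure (m : nat) : {measure set boundary -> \bar R} :=
  msum (fun i => atom (Two :: nth [::] (level m) i)) (size (level m)).

Definition atomic_measure : set boundary -> \bar R :=
  measure_add (atom [::]) (mseries level_measure 0).

HB.instance Definition _ := Measure.on atomic_measure.

Lemma atomE w A : atom w A = (tail_mass f w * \1_A (Phi_pt w))%:E.
Proof. by rewrite EFinM. Qed.

Lemma atomic_measureE A : (atomic_measure A =
  (tail_mass f [::] * \1_A (Phi_pt [::]))%:E +
  \esum_(w in [set: fword]) (tail_mass f (Two :: w) * \1_A (Phi_pt (Two :: w)))%:E)%E.
Proof.
rewrite [LHS]measure_addE atomE; congr (_ + _)%E.
rewrite esum_words => [|w]; last by rewrite lee_fin mulr_ge0 ?tail_mass_ge0.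
apply: eq_eseriesr => m _; rewrite /level_measure /msum /= (big_nth [::]) big_mkord.
by apply: eq_bigr => i _; exact: atomE.
Qed.

Lemma integral_atom w v :
  (\int[atom w]_om (om v)%:E = (tail_mass f w * Phi_ones w v)%:E)%E.
Proof.
rewrite ge0_integral_mscale //; last first.
- by move=> om _; rewrite lee_fin ext_fun_ge0.
- exact: measurable_evalE.
rewrite integral_dirac //; last exact: measurable_evalE.
by rewrite diracT mul1e.
Qed.

Lemma represents_atomic_integral v :
  ((f v)%:E = \int[atomic_measure]_om (om v)%:E)%E.
Proof.
have ge0 om : setT om -> (0 <= (om v)%:E)%E by rewrite lee_fin ext_fun_ge0.
have mv := measurable_evalE v.
rewrite ge0_integral_measure_add // integral_atom harmonic_expansion.
congr (_ + _)%E; rewrite ge0_integral_measure_series // esum_words => [|w]; last first.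
  by rewrite lee_fin mulr_ge0 ?tail_mass_ge0 ?Phi_ones_ge0.
apply: eq_eseriesr => m _; rewrite ge0_integral_measure_sum //.
by rewrite (big_nth [::]) big_mkord; apply: eq_bigr => i _; rewrite integral_atom.
Qed.

(** The total mass is the expansion of [f] at the root, where all path functions equal 1. *)
Lemma atomic_measure_setT : atomic_measure setT = 1%E.
Proof.
rewrite -[RHS]/(1%:E) -f1 harmonic_expansion atomic_measureE indicT.
congr (_ + _)%E; first by rewrite Phi_ones_nil.
by apply: eq_esum => w _; rewrite Phi_ones_nil.
Qed.

HB.instance Definition _ :=
  Measure_isProbability.Build _ _ _ atomic_measure atomic_measure_setT.

Definition atomic_probability : probability boundary R := atomic_measure.

Lemma represents_atomic : represents atomic_probability f.
Proof. exact: represents_atomic_integral. Qed.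

Lemma represents_point_setI (nu : probability boundary R) w A : represents nu f ->
  nu ([set om | ext_fun om = Phi_ones w] `&` A) =
  (tail_mass f w * \1_A (Phi_pt w))%:E.
Proof.
move=> hnu; have S1 om : ext_fun om = Phi_ones w -> om = Phi_pt w.
  by move=> e; exact: ext_fun_inj.
rewrite indicE; case: (boolP (Phi_pt w \in A)); rewrite ?inE ?notin_setE => Aw.
  rewrite setIidl ?mulr1 ?represents_atom //.
  by move=> om /= /S1 ->.
rewrite mulr0 (_ : _ `&` A = set0) ?measure0 //.
by apply/seteqP; split => // om [/= /S1 ->].
Qed.

(** Any representing measure has the same masses at the path points, and finitely many such points
    in [A] form a disjoint union inside [A]. *)
Lemma atomic_measure_le (nu : probability boundary R) A : represents nu f ->
  measurable A -> (atomic_measure A <= nu A)%E.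
Proof.
move=> hnu mA; rewrite atomic_measureE -leeBrDl //.
pose F w := [set om : boundary | ext_fun om = Phi_ones w] `&` A.
have mF w : measurable (F w) by apply: measurableI => //; exact: measurable_point.
(* [\esum] is the supremum of its finite partial sums, so a finite set [X] of words is enough. *)
apply: ge_ereal_sup => _ [X [finX _] <-]; rewrite leeBrDl //.
have -> : (\sum_(w \in X) (tail_mass f (Two :: w) * \1_A (Phi_pt (Two :: w)))%:E)%E
    = nu (\bigcup_(w in X) F (Two :: w)).
  rewrite measure_fin_bigcup //; last first.
    move=> v w _ _ [om [[/= ev _] [/= ew _]]]; apply: (@Phi12_inj R).
    by rewrite !Phi12E -ev -ew.
  by apply: eq_fsbigr => w _; rewrite -(represents_point_setI _ _ hnu).
rewrite -(represents_point_setI [::] A hnu) -measureU; last 3 first.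
- exact: (mF [::]).
- exact: fin_bigcup_measurable.
- apply/seteqP; split => // om [[/= e _] [w _ [/= e' _]]].
  by apply: (@Phi12_neq_Phi1 R w); rewrite Phi12E Phi1E -e -e'.
apply: le_measure; rewrite ?inE //.
  by apply: measurableU; [exact: (mF [::])|exact: fin_bigcup_measurable].
by move=> om [[]|[w _ []]].
Qed.

(** The inequality for [A] and for its complement, between measures of total mass 1, gives
    equality. *)
Lemma represents_unique (nu : probability boundary R) A : represents nu f ->
  measurable A -> nu A = atomic_probability A.
Proof.
move=> hnu mA; have le1 := atomic_measure_le hnu mA.
have := atomic_measure_le hnu (measurableC mA).
rewrite -[atomic_measure]/(atomic_probability : set _ -> _) in le1 *.
rewrite !probability_setC //.
have fn := fin_num_measure nu A mA; have fm := fin_num_measure atomic_probability A mA.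
rewrite -(fineK fn) -(fineK fm) in le1 *.
rewrite -!EFinB lee_fin lerD2l lerN2 => le2; apply/eqP.
by rewrite eq_le lee_fin le2 le1.
Qed.

End Represent.
End Boundary.

Unset Implicit Arguments.

Theorem corollary15p7 (R : realType) (x y c t : nat -> R)
  (c_gt0 : forall k : nat, (0 < k)%N -> 0 < c k)
  (t0 : t 0%N = 0)
  (t_gt0 : forall k : nat, (0 < k)%N -> 0 < t k)
  (xE : forall k : nat, (0 < k)%N -> x k = c k * (1 + t k.-1))
  (yE : forall k : nat, (0 < k)%N -> y k = c k * c k.+1 * t k)
  (t_cvg : convergent_type t)
  (muI_gt0 : 0 < muI x y [::]) :
  [/\ extremal (@Phi1 R),
      (forall w : fword, extremal (@Phi12 R w)),
      (exists mu : probability (extremal_boundary R) R,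
        [/\ represents mu (clone_harmonic x y),
            (forall nu : probability (extremal_boundary R) R,
               represents nu (clone_harmonic x y) ->
               forall A : set (extremal_boundary R), measurable A -> nu A = mu A),
            (forall A : set (extremal_boundary R), measurable A ->
               mu A = typeI_component x y A) &
            [/\ mu (~` [set om : extremal_boundary R | ext_fun om = @Phi1 R \/
                        exists w : fword, ext_fun om = @Phi12 R w]) = 0%E,
                mu [set om : extremal_boundary R | ext_fun om = @Phi1 R] =
                  (muI x y [::])%:E &
                forall w : fword,
                  mu [set om : extremal_boundary R | ext_fun om = @Phi12 R w] =
                  (muI x y (Two :: w))%:E]]) &
      (forall v : fword,
        (clone_harmonic x y v)%:E =
        ((muI x y [::] * @Phi1 R v)%:E +
         \esum_(w in [set: fword]) (muI x y (Two :: w) * @Phi12 R w v)%:E)%E)].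
have phi_nn : normalized_nonneg_harmonic (clone_harmonic x y).
  split; first exact: (clone_harmonic_ge0 t0 t_gt0 c_gt0 xE yE t_cvg).
  - exact: (clone_harmonic_nil t0 c_gt0 xE yE).
  - exact: (harmonic_clone t0 t_gt0 c_gt0 xE yE).
have total : partial_expansion (clone_harmonic x y) ^~ [::] @ \oo --> (1 : R).
  rewrite -(clone_harmonic_nil t0 c_gt0 xE yE).
  exact: (cvg_partial_expansion_clone t0 t_gt0 c_gt0 xE yE t_cvg muI_gt0).
have PhiE : (@Phi12 R) = fun w => Phi_ones (Two :: w).
  by apply/funext => w; exact: Phi12E.
split.
- exact: Phi1_extremal.
- by move=> w; rewrite PhiE; exact: Phi_ones_extremal.
- exists (atomic_probability phi_nn total); split.
  + exact: represents_atomic.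
  + by move=> nu hnu A mA; exact: represents_unique.
  + move=> A mA; rewrite [LHS]atomic_measureE /typeI_component Phi1E PhiE.
    rewrite indic_ext_fun muIE; congr (_ + _)%E; apply: eq_esum => w _.
    by rewrite indic_ext_fun muIE.
  + split.
    (* Every atom lies in [S], so each term of the sum for the complement vanishes. *)
    * set S := [set om | _].
      have S0 w : S (Phi_pt w) -> \1_(~` S) (Phi_pt w) = 0 :> R.
        by move=> Sw; rewrite indicE memNset //= => /(_ Sw).
      rewrite [LHS]atomic_measureE S0 ?mulr0 ?add0e; last by left; rewrite Phi1E.
      apply: esum1 => w _; rewrite S0 ?mulr0 //.
      by right; exists w; rewrite PhiE.
    * by rewrite Phi1E (represents_atom phi_nn) ?muIE //; exact: represents_atomic.
    * move=> w; rewrite PhiE (represents_atom phi_nn) ?muIE //; exact: represents_atomic.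
- move=> v; rewrite [LHS](harmonic_expansion phi_nn total) Phi1E PhiE muIE.
  by congr (_ + _)%E; apply: eq_esum => w _; rewrite muIE.
Qed.
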